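(* Let $n\ge2$ and let $\mathbf{V}=(V_1,\ldots,V_n)$ be a commuting $n$-tuple of bounded operators on a Hilbert space $\mathcal H$. If $\mathbf{V}$ is a $\mathbf{\Theta}_n$-isometry, then for every $\alpha\in\mathbb T$ the $(n+1)$-tuple $$(\alpha^mI+V_1,\ \alpha^mV_1+V_2,\ \ldots,\ \alpha^mV_{n-2}+V_{n-1},\ \alpha^mV_{n-1}+V_n^p,\ \alpha^{m/p}V_n)$$ is a $\mathbf{\Theta}_{n+1}$-isometry.
   Context: Fix integers $m,p\ge 1$ with $p\mid m$ and put $q=m/p$. $\mathbb T$ is the unit circle in $\mathbb C$ and $\mathbb D$ the open unit disc. For $d\ge1$ and $z=(z_1,\ldots,z_d)\in\mathbb C^d$ let $s_i(z)=\sum_{1\le k_1<\cdots<k_i\le d}z_{k_1}\cdots z_{k_i}$. Define $\theta=(\theta_1,\ldots,\theta_d)$ by $\theta_i(z)=s_i(z_1^m,\ldots,z_d^m)$ for $1\le i\le d-1$ and $\theta_d(z)=(z_1\cdots z_d)^q$; put $\mathbf{\Theta}_d=\theta(\mathbb D^d)$, whose distinguished (Shilov) boundary is $b\mathbf{\Theta}_d=\theta(\mathbb T^d)$. The same $m,p$ are used for $d=n$ and $d=n+1$. A $\mathbf{\Theta}_d$-unitary is a commuting $d$-tuple of bounded normal operators whose joint spectrum is contained in $b\mathbf{\Theta}_d$. A $\mathbf{\Theta}_d$-isometry on $\mathcal H$ is a commuting $d$-tuple $(V_1,\ldots,V_d)$ for which there are a Hilbert space $\mathcal K\supseteq\mathcal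 H$ and a $\mathbf{\Theta}_d$-unitary $(N_1,\ldots,N_d)$ on $\mathcal K$ with $V_i=N_i|_{\mathcal H}$ for $1\le i\le d$. For $n=2$ the tuple in the claim is $(\alpha^mI+V_1,\alpha^mV_1+V_2^p,\alpha^{m/p}V_2)$. *)

(* Defs.v *)
From HB Require Import structures.
Set Warnings "-notation-overridden,-ambiguous-paths".
From mathcomp Require Import all_boot all_order all_algebra complex.
From mathcomp Require Import classical_sets reals topology normedtype.

Set Implicit Arguments.
Unset Strict Implicit.
Unset Printing Implicit Defensive.

Import Order.TTheory GRing.Theory Num.Theory.

Local Open Scope classical_set_scope.
Local Open Scope complex_scope.
Local Open Scope ring_scope.

(* Complex Hilbert spaces.  The inner product is linear in its first argument
   and conjugate-linear in the second; as in [normedModType], the norm takes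
   its values in the scalar field [R[i]]. *)
HB.mixin Record isHilbert (R : realType) (H : Type)
    of CompleteNormedModule R[i] H := {
  inner : {dot H for @Num.conj R[i]} ;
  inner_norm : forall x : H, inner x x = `|x| ^+ 2
}.

#[short(type="hilbertType")]
HB.structure Definition Hilbert (R : realType) :=
  {H of isHilbert R H & CompleteNormedModule R[i] H}.

Section Operators.
Variables (R : realType) (H : hilbertType R).
Implicit Types (N A : H -> H).

Definition bounded_operator N : Prop :=
  linear N /\ exists M : R, forall x, `|N x| <= M%:C * `|x|.

Definition is_adjoint N A : Prop :=
  forall x y, inner (N x) y = inner x (A y).

Definition normal_operator N : Prop :=
  bounded_operator N /\
  exists A, [/\ bounded_operator A, is_adjoint N A & N \o A =1 A \o N].

Section Tuples.
Variable d : nat.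
Implicit Types (T : 'I_d -> H -> H).

Definition commuting_operators T : Prop :=
  (forall i, bounded_operator (T i)) /\
  (forall i j, T i \o T j =1 T j \o T i).

(* Koszul differential on [H (x) Lambda(C^d)]: an element is the family
   [(f B)_B] of its coordinates on the basis [e_B = e_{b1} /\ .. /\ e_{bk}]
   with [b1 < .. < bk] the elements of [B], and the differential is
   [x (x) e_B |-> \sum_i T_i x (x) (e_i /\ e_B)]. *)
Definition koszul T (f : {set 'I_d} -> H) : {set 'I_d} -> H :=
  fun B => \sum_(i in B) (-1) ^+ #|[set j in B | (j < i)%N]| *: T i (f (B :\ i)).

(* Exactness of the Koszul complex in all degrees at once. *)
Definition koszul_exact T : Prop :=
  forall f, koszul T f =1 (fun=> 0) -> exists g, f =1 koszul T g.

(* Joint spectrum in the sense of Taylor. *)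
Definition joint_spectrum T : set ('I_d -> R[i]) :=
  [set w | ~ koszul_exact (fun i x => T i x - w i *: x)].

End Tuples.
End Operators.

Section Theta.
Variables (R : realType) (d m p : nat).

Definition elem_sym (k : nat) (z : 'I_d -> R[i]) : R[i] :=
  \sum_(B : {set 'I_d} | #|B| == k) \prod_(j in B) z j.

(* Indices are 0-based: coordinate [i] is the usual [theta_{i+1}], and [i.+1]
   is the degree of the symmetric polynomial. *)
Definition theta (z : 'I_d -> R[i]) : 'I_d -> R[i] :=
  fun i => if i.+1 == d then (\prod_j z j) ^+ (m %/ p)
           else elem_sym i.+1 (fun j => z j ^+ m).

Definition bTheta : set ('I_d -> R[i]) :=
  [set theta z | z in [set z : 'I_d -> R[i] | forall j, `|z j| = 1]].

Definition Theta_unitary (K : hilbertType R) (N : 'I_d -> K -> K) : Prop :=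
  [/\ commuting_operators N, forall i, normal_operator (N i)
    & joint_spectrum N `<=` bTheta].

(* The inclusion of [H] in the larger space is an isometric embedding [J]. *)
Definition Theta_isometry (H : hilbertType R) (V : 'I_d -> H -> H) : Prop :=
  commuting_operators V /\
  exists (K : hilbertType R) (J : {linear H -> K}) (N : 'I_d -> K -> K),
    [/\ forall x y, inner (J x) (J y) = inner x y,
        Theta_unitary N
      & forall i x, N i (J x) = J (V i x)].

End Theta.

Section Extension.
Variables (R : realType) (H : hilbertType R) (n : nat).

(* In the 1-based indexing [V_1, .., V_n], the entry [i : 'I_n.+1]
   is [V_i], with [V_0 = I]. *)
Definition shift_tuple (V : 'I_n -> H -> H) (i : 'I_n.+1) : H -> H :=
  if unlift ord0 i is Some j then V j else id.

(* The [(n+1)]-tuple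
   [(a^m I + V_1, a^m V_1 + V_2, .., a^m V_{n-1} + V_n^p, a^(m/p) V_n)]. *)
Definition extend_tuple (m p : nat) (a : R[i]) (V : 'I_n -> H -> H)
    (i : 'I_n.+1) : H -> H := fun x =>
  if unlift ord_max i is Some j then
    a ^+ m *: shift_tuple V i x + (if j.+1 == n then iter p (V j) x else V j x)
  else a ^+ (m %/ p) *: shift_tuple V i x.

End Extension.

(* Main.v *)
(* A [Theta_n]-unitary dilation [N] of [V] yields the dilation [extend_tuple N]
   of [extend_tuple V], on the same space.

   Normality of its entries is Fuglede's theorem.  For [A] normal and
   [A B = B A], the operators [F = (1 - l A^*/k)^k B (1 + l A^*/k)^k] satisfy
   [|F x| <= |B| (1 + |l|^2 |A|^2 / k^2)^k |x|], because normality allows to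
   replace [A^*] by [A] in norms and [A] commutes with [B].  So [F] is bounded
   independently of [l] for large [k], whereas its coefficient of [l] is
   [B A^* - A^* B]; a Cauchy estimate makes that coefficient vanish.

   For the joint spectrum, [w] determines [z] with [w = f z] outside the [n]-th
   coordinate, [f] being the polynomial map defining the extension.  Elementary
   operations then identify the Koszul complex of [f N - w] with the one of
   [(N - z, c)] with [c] the defect in the remaining coordinate: it is exact if
   [c] is nonzero, or if the complex of [N - z] is exact.  Finally,
   [f (theta t) = theta (t, a)]. *)
From HB Require Import structures.
Require Import Defs.
Set Warnings "-notation-overridden,-ambiguous-paths".
From mathcomp Require Import all_boot all_order all_algebra complex.
From mathcomp Require Import boolp classical_sets functions reals topology.
From mathcomp Require Import normedtype.
From mathcomp Require Import finset cyclic separable cyclotomic zify ring.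

Set Implicit Arguments.
Unset Strict Implicit.
Unset Printing Implicit Defensive.

Import Order.TTheory GRing.Theory Num.Theory.
Local Open Scope ring_scope.

(** * Roots of unity and a discrete Cauchy estimate *)

(** In characteristic 0 the polynomial ['X^n - 1] is separable, so it has [n] distinct roots; a set
    of [n] distinct [n]-th roots of unity contains a primitive one. *)
Lemma complex_prim_root_exists (R : realType) n :
  (0 < n)%N -> exists z : R[i], n.-primitive_root z.
Proof.
move=> n_gt0; pose p : {poly R[i]} := 'X^n - 1.
have [r Dp] := closed_field_poly_normal p.
rewrite (monicP _) ?monicXnsubC // scale1r in Dp.
have rn1 : all n.-unity_root r by apply/allP=> z; rewrite -root_prod_XsubC -Dp.
have sz_r : (n < (size r).+1)%N.
  by rewrite -(size_prod_XsubC r id) -Dp size_XnsubC.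
have [|z] := hasP (has_prim_root n_gt0 rn1 _ sz_r); last by exists z.
by rewrite -separable_prod_XsubC -Dp separable_Xn_sub_1 // pnatr_eq0 -lt0n.
Qed.

Lemma prim_root_sum0 (F : fieldType) N (w : F) e :
  N.-primitive_root w -> ~~ (N %| e)%N -> \sum_(l < N) (w ^+ l) ^+ e = 0.
Proof.
move=> pw Ne; have we : w ^+ e - 1 != 0.
  by rewrite subr_eq0 -(expr0 w) (eq_prim_root_expr pw) eqn_mod_dvd // subn0.
apply: (mulfI we); rewrite mulr0.
under eq_bigr do rewrite -exprM mulnC exprM.
by rewrite -subrX1 -exprM mulnC exprM (prim_expr_order pw) expr1n subrr.
Qed.

(* Discrete Cauchy estimate: averaging over the [N]-th roots of unity extracts
   the coefficient of degree 1. *)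
Lemma coef1_le (R : realType) (H : hilbertType R) N (v : nat -> H)
    (r c : R[i]) :
  (1 < N)%N -> 0 <= r ->
  (forall l : R[i], `|l| = r -> `|\sum_(j < N) l ^+ j *: v j| <= c) ->
  r * `|v 1%N| <= c.
Proof.
move=> N1 r0 hb; have N0 : (0 < N)%N by exact: ltnW.
have [w pw] := @complex_prim_root_exists R N N0.
have w1 : `|w| = 1.
  apply: (@pexpIrn _ N) => //; rewrite ?nnegrE ?ler01 //.
  by rewrite -normrX (prim_expr_order pw) normr1 expr1n.
pose G l := \sum_(j < N) l ^+ j *: v j.
(* The weight [(w ^+ l) ^+ N.-1] is the inverse of [w ^+ l], so the terms of degree 1 lose their
   phase and add up. *)
have E : \sum_(l < N) (w ^+ l) ^+ N.-1 *: G (r * w ^+ l) = (N%:R * r) *: v 1%N.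
  rewrite /G; under eq_bigr do rewrite scaler_sumr.
  rewrite exchange_big /= (bigD1 (Ordinal N1)) //= [X in _ + X]big1 ?addr0.
    under eq_bigr do rewrite expr1 scalerA mulrC -mulrA -exprS prednK //
      exprAC (prim_expr_order pw) expr1n mulr1.
    by rewrite sumr_const card_ord -scaler_nat scalerA.
  move=> j j1; under eq_bigr do
    rewrite scalerA exprMn mulrC -mulrA -exprD.
  rewrite -scaler_suml -mulr_sumr (@prim_root_sum0 _ N) ?mulr0 ?scale0r //.
  (* For [j < N], the exponent [j + N - 1] is a multiple of [N] only when [j = 1]. *)
  rewrite -(subn1 N) addnBA //; apply: contra j1 => /dvdnP[q jq].
  rewrite -val_eqE /=; have jN := ltn_ord j; case: (q) jq => [|[|q']] jq.
  - by move: jq; case: (val j) => //= *; lia.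
  - apply/eqP; move: jq; lia.
  - move: jq; rewrite !mulSn; lia.
have : `|(N%:R * r) *: v 1%N| <= N%:R * c.
  rewrite -E (le_trans (ler_norm_sum _ _ _)) //.
  rewrite mulr_natl -[X in _ *+ X](card_ord N) -sumr_const ler_sum // => l _.
  rewrite normrZ !normrX w1 !expr1n mul1r hb // normrM !normrX w1 expr1n mulr1.
  exact: ger0_norm.
rewrite normrZ normrM normr_nat (ger0_norm r0) -mulrA ler_pM2l // ltr0n //.
Qed.

(** * Normal operators and Fuglede's theorem *)

Section Fuglede.
Variables (R : realType) (H : hilbertType R).
Implicit Types (f g : H -> H) (A As B T : {linear H -> H}).

Lemma inner_conj (x y : H) : inner x y = (inner y x)^*.
Proof. by rewrite hermC expr0 mul1r. Qed.

Lemma innerDl (x y z : H) : inner (x + y) z = inner x z + inner y z.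
Proof. exact: linearDl. Qed.

Lemma innerZl c (x y : H) : inner (c *: x) y = c * inner x y.
Proof. exact: linearZl_LR. Qed.

Lemma innerDr (x y z : H) : inner x (y + z) = inner x y + inner x z.
Proof. exact: linearDr. Qed.

Lemma innerZr c (x y : H) : inner x (c *: y) = c^* * inner x y.
Proof. exact: linearZr_LR. Qed.

Lemma is_adjoint_sym f g : is_adjoint f g -> is_adjoint g f.
Proof. by move=> fg x y; rewrite inner_conj -fg -inner_conj. Qed.

Lemma is_adjoint_iter f g k :
  is_adjoint f g -> is_adjoint (iter k f) (iter k g).
Proof. by move=> fg; elim: k => //= k IH x y; rewrite fg IH -iterSr. Qed.

Lemma iter_commute (X : Type) (f g : X -> X) k x :
  f \o g =1 g \o f -> iter k f (g x) = g (iter k f x).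
Proof. by move=> fg; elim: k => //= k ->; exact: fg. Qed.

Lemma iter_commute2 (X : Type) (f g : X -> X) k : f \o g =1 g \o f ->
  iter k f \o iter k g =1 iter k g \o iter k f.
Proof.
move=> fg x /=; apply/esym/iter_commute => y /=.
by apply/esym/iter_commute.
Qed.

Lemma iter_comp_commute (X : Type) (f g : X -> X) k x :
  f \o g =1 g \o f -> iter k f (iter k g x) = iter k (f \o g) x.
Proof.
move=> fg; elim: k => //= k IH; rewrite -IH; congr (f _).
exact: iter_commute.
Qed.

(** The two squared norms are the inner products of [x] with [g (f x)] and with [f (g x)]. *)
Lemma normal_norm f g x : is_adjoint f g -> f \o g =1 g \o f -> `|f x| = `|g x|.
Proof.
move=> fg c; apply: (@pexpIrn _ 2) => //; rewrite ?nnegrE ?normr_ge0 //.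
rewrite -!inner_norm fg (is_adjoint_sym fg); congr (inner _ _); exact/esym/c.
Qed.

(** One factor of the product approximating an exponential: with [c = l / k], the [k]-th iterate
    replaces [exp (l f)] and stays polynomial in [l]. *)
Definition id_plus (c : R[i]) f x := x + c *: f x.

Lemma is_adjoint_id_plus c f g :
  is_adjoint f g -> is_adjoint (id_plus c f) (id_plus c^* g).
Proof.
by move=> fg x y; rewrite /id_plus innerDl innerDr innerZl innerZr conjCK fg.
Qed.

Lemma id_plus_commute c A B :
  A \o B =1 B \o A -> id_plus c A \o B =1 B \o id_plus c A.
Proof. by move=> AB x; rewrite /= /id_plus linearD linearZ_LR [A _]AB. Qed.

Fact id_plus_linear c A : linear (id_plus c A).
Proof.
move=> d x y; rewrite /id_plus linearP !scalerDr !scalerA (mulrC c).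
by rewrite addrACA.
Qed.

HB.instance Definition _ c A :=
  GRing.isLinear.Build _ _ _ _ (id_plus c A) (id_plus_linear c A).

Lemma id_plus_commute2 c d A B : A \o B =1 B \o A ->
  id_plus c A \o id_plus d B =1 id_plus d B \o id_plus c A.
Proof.
move=> AB. apply: (@id_plus_commute c A (id_plus d B)) => x /=.
by symmetry; apply: id_plus_commute => y; symmetry; exact: AB.
Qed.

(** [G] is a polynomial of degree below [N] with coefficients in [H]; only the coefficients of
    degree 0 and 1 are recorded, the Cauchy estimate being insensitive to the others. *)
Definition coef01 N (G : R[i] -> H) v0 v1 := exists v : nat -> H,
  [/\ v 0%N = v0, v 1%N = v1 & forall l, G l = \sum_(j < N) l ^+ j *: v j].

Lemma coef01_step N G v0 v1 e T : (1 < N)%N -> coef01 N G v0 v1 ->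
  coef01 N.+1 (fun l => id_plus (l * e) T (G l)) v0 (v1 + e *: T v0).
Proof.
move=> N1 [v [<- <- Gv]].
(* The new coefficients are [v j + e *: T (v j.-1)], where [v] is cut off at [N] and shifted in with
   0 in front. *)
exists (fun j => (if (j < N)%N then v j else 0) +
                 (if j is j'.+1 then e *: T (v j') else 0)).
split; first by rewrite addr0 ltnW.
  by rewrite N1.
move=> l; rewrite /id_plus Gv; under [RHS]eq_bigr do rewrite scalerDr.
rewrite big_split /=; congr (_ + _).
  rewrite big_ord_recr /= ltnn scaler0 addr0.
  by apply: eq_bigr => j _; rewrite ltn_ord.
rewrite big_ord_recl /= scaler0 add0r linear_sum scaler_sumr.
apply: eq_bigr => j _; rewrite linearZ_LR !scalerA exprS; congr (_ *: _).
by rewrite -mulrA [e * _]mulrC mulrA.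
Qed.

Lemma coef01_iter N G v0 v1 e T k : (1 < N)%N -> coef01 N G v0 v1 ->
  coef01 (N + k) (fun l => iter k (id_plus (l * e) T) (G l)) v0
         (v1 + (k%:R * e) *: T v0).
Proof.
move=> N1 Gv; elim: k => [|k IH].
  by rewrite addn0 mul0r scale0r addr0.
rewrite addnS -natr1 mulrDl mul1r scalerDl addrA.
by apply: coef01_step IH; rewrite ltn_addr.
Qed.

Lemma coef01_linear N G v0 v1 T : coef01 N G v0 v1 ->
  coef01 N (fun l => T (G l)) (T v0) (T v1).
Proof.
move=> [v [<- <- Gv]]; exists (T \o v); split => // l.
by rewrite Gv linear_sum; apply: eq_bigr => j _; rewrite linearZ_LR.
Qed.

Lemma iter_norm_le f (c : R[i]) k x :
  0 <= c -> (forall y, `|f y| <= c * `|y|) -> `|iter k f x| <= c ^+ k * `|x|.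
Proof.
move=> c0 fc; elim: k => [|k IH]; first by rewrite mul1r.
by rewrite exprS -mulrA (le_trans (fc _)) ?ler_wpM2l.
Qed.

(** By induction [(1 + u) ^+ j <= 1 + 2 j u] for [j <= k]: the quadratic term [2 j u ^+ 2] is
    absorbed by [u] because [2 j u <= 1]. *)
Lemma expr_1Du_le2 (u : R[i]) k : 0 <= u -> 2 * k%:R * u <= 1 ->
  (1 + u) ^+ k <= 2.
Proof.
move=> u0 ku.
suff: forall j, (j <= k)%N -> (1 + u) ^+ j <= 1 + 2 * j%:R * u.
  by move=> /(_ k (leqnn k)) /le_trans -> //; rewrite -[leRHS]/(1 + 1) lerD2l.
elim=> [|j IH] jk; first by rewrite mulr0 mul0r addr0.
rewrite exprS (le_trans (ler_wpM2l _ (IH (ltnW jk)))) ?addr_ge0 //.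
have h : (2 * j%:R * u) * u <= u.
  rewrite ler_piMl // (le_trans _ ku) // ler_wpM2r // ler_wpM2l //.
  by rewrite ler_nat ltnW.
have jS : j.+1%:R = j%:R + 1 :> R[i] by rewrite natr1.
rewrite -subr_ge0 jS.
have -> : 1 + 2 * (j%:R + 1) * u - (1 + u) * (1 + 2 * j%:R * u)
  = u - 2 * j%:R * u * u by ring.
by rewrite subr_ge0.
Qed.

(** Archimedean property of [R]; [t] and [c] are comparable with 0, hence real. *)
Lemma natr_mul_bounded_eq0 (t c : R[i]) :
  0 <= t -> (forall r : nat, r%:R * t <= c) -> t = 0.
Proof.
move=> t0 tc; have c0 : 0 <= c by have := tc 0%N; rewrite mul0r.
have /complex_realP[s st] := ger0_real t0.
have /complex_realP[d dc] := ger0_real c0.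
move: t0 tc; rewrite {}st {}dc ler0c => s0 tc; congr (_%:C)%C.
apply/eqP; rewrite eq_le s0 andbT leNgt; apply/negP => sp.
have := tc (Num.truncn (d / s)).+1.
rewrite -(rmorph_nat (real_complex R)) -rmorphM /= lecR leNgt => /negP; apply.
by rewrite -ltr_pdivrMr // truncnS_gt.
Qed.

Lemma Fuglede A As B M b :
  is_adjoint A As -> A \o As =1 As \o A -> A \o B =1 B \o A ->
  (forall x, `|A x| <= M%:R * `|x|) -> (forall x, `|B x| <= b%:R * `|x|) ->
  As \o B =1 B \o As.
Proof.
move=> adj nrm AB AM Bb x; apply/eqP; rewrite eq_sym -subr_eq0 -normr_eq0 /=.
(* [r] is the radius of the Cauchy circle; the bound [2 b |x|] on the circle will not depend on
   it. *)
apply/eqP/(@natr_mul_bounded_eq0 _ (2 * b%:R * `|x|)) => // r.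
(* This [k] ensures [2 k (r M / k)^2 <= 1], the condition for the [k]-th power below to be at most
   2. *)
pose k := (2 * r ^ 2 * M ^ 2).+1; pose e : R[i] := k%:R^-1.
have k0 : k%:R != 0 :> R[i] by rewrite pnatr_eq0.
have : coef01 (2 + k + k)
    (fun l => iter k (id_plus (l * - e) As) (B (iter k (id_plus (l * e) As) x)))
    (B x) (B (As x) - As (B x)).
  (* Start from the constant polynomial [x], padded to two coefficients. As [k e = 1], the inner
     factors contribute [As x] in degree 1, and the outer ones [- As (B x)]. *)
  have := @coef01_iter 2 (fun=> x) x 0 e As k erefl.
  case=> [|v [v0 v1 Gv]].
    exists (fun j => if j is 0 then x else 0); split => // l.
    by rewrite big_ord_recl big_ord1 /= scaler0 addr0 scale1r.
  have := @coef01_linear _ _ _ _ B (ex_intro _ v (And3 v0 v1 Gv)).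
  move=> /(@coef01_iter (2 + k) _ _ _ (- e) As k erefl).
  rewrite add0r mulrN /e mulfV //.
  by rewrite scale1r scaleN1r.
move=> [v [_ <- Gv]]; apply: (@coef1_le _ _ (2 + k + k) v) => // l lr.
rewrite -Gv mulrN.
pose u := l * e; rewrite -/u; pose p' := id_plus (- u)^* A.
have AsA : As \o A =1 A \o As by move=> y; rewrite nrm.
(* The outer factor is normal, so its adjoint gives the same norm; the adjoint is a polynomial in
   [A] and can be moved past [B]. *)
have -> : `|iter k (id_plus (- u) As) (B (iter k (id_plus u As) x))| =
          `|iter k p' (B (iter k (id_plus u As) x))|.
  apply: normal_norm; last exact/iter_commute2/id_plus_commute2.
  exact/is_adjoint_iter/is_adjoint_id_plus/is_adjoint_sym.
rewrite iter_commute; last exact: id_plus_commute.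
rewrite iter_comp_commute; last exact: id_plus_commute2.
rewrite (le_trans (Bb _)) // -[2 * _]mulrC -mulrA ler_wpM2l //.
(* Normality again replaces [As] by [A], and the product becomes [1 - v^2 A^2] with [v] the
   conjugate of [u]. The cancelled linear term is what keeps the [k]-th power bounded. *)
have fM y :
    `|(p' \o id_plus u As) y| <= (1 + `|u| ^+ 2 * M%:R ^+ 2) * `|y|.
  rewrite [(_ \o _) y](id_plus_commute2 _ _ nrm) /=.
  have -> : `|id_plus u As (p' y)| = `|id_plus u^* A (p' y)|.
    apply: normal_norm; last exact: id_plus_commute2.
    exact/is_adjoint_id_plus/is_adjoint_sym.
  rewrite /p' rmorphN /id_plus /= scaleNr.
  rewrite linearB [A (_ *: _)]linearZ_LR scalerBr addrA addrNK scalerA.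
  rewrite (le_trans (ler_normB _ _)) // mulrDl mul1r lerD2l normrZ.
  rewrite normrM norm_conjC -expr2 -mulrA ler_wpM2l ?exprn_ge0 //.
  by rewrite (le_trans (AM _)) // expr2 -mulrA ler_wpM2l.
apply: (le_trans (iter_norm_le _ _ _ fM)).
  by rewrite addr_ge0 // mulr_ge0 ?exprn_ge0.
rewrite ler_wpM2r // expr_1Du_le2 ?mulr_ge0 ?exprn_ge0 //.
rewrite normrM lr /e normfV normr_nat exprMn exprVn.
rewrite -!natrX -!natrM.
have -> : (2 * k)%:R * ((r ^ 2)%:R / (k ^ 2)%:R * (M ^ 2)%:R) =
          (2 * k * r ^ 2 * M ^ 2)%:R / (k ^ 2)%:R :> R[i].
  by rewrite !natrM; ring.
rewrite ler_pdivrMr ?ltr0n ?expn_gt0 // mul1r ler_nat expnS expn1.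
have -> : (2 * k * r ^ 2 * M ^ 2 = k * (2 * r ^ 2 * M ^ 2))%N by ring.
by rewrite leq_mul2l leqW.
Qed.
End Fuglede.

(** * Algebra of bounded and normal operators *)

Section NormalOperators.
Variables (R : realType) (H : hilbertType R).
Implicit Types (f g h : H -> H).

Lemma linear_ex f : linear f -> exists f' : {linear H -> H}, f = f'.
Proof.
move=> lf; exists (HB.pack_for {linear H -> H} f
  (GRing.isLinear.Build R[i] H H _ f lf)) => //.
Qed.

(** Natural bounds live in [R] and in [R[i]] alike, and are the form used in [Fuglede]. *)
Lemma bounded_natP f : bounded_operator f <->
  linear f /\ exists M : nat, forall x, `|f x| <= M%:R * `|x|.
Proof.
split=> -[lf [M fM]]; split=> //; last first.
  by exists M%:R => x; rewrite rmorph_nat.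
exists (Num.truncn M).+1 => x; rewrite (le_trans (fM x)) // ler_wpM2r //.
by rewrite -(rmorph_nat (real_complex R)) lecR ltW // truncnS_gt.
Qed.

Lemma bounded_id : bounded_operator (@id H).
Proof. by apply/bounded_natP; split=> //; exists 1%N => x; rewrite mul1r. Qed.

Lemma bounded_comp f g :
  bounded_operator f -> bounded_operator g -> bounded_operator (f \o g).
Proof.
move=> /bounded_natP[lf [M fM]] /bounded_natP[lg [N gN]].
apply/bounded_natP; split=> [c x y|]; first by rewrite /= lg lf.
exists (M * N)%N => x; rewrite (le_trans (fM _)) // natrM -mulrA.
by rewrite ler_wpM2l.
Qed.

Lemma bounded_iter p f : bounded_operator f -> bounded_operator (iter p f).
Proof.
by move=> bf; elim: p => [|p IH]; [exact: bounded_id | exact: bounded_comp].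
Qed.

Lemma bounded_scale c f :
  bounded_operator f -> bounded_operator (fun x => c *: f x).
Proof.
move=> /bounded_natP[lf [M fM]]; split=> [d x y|].
  by rewrite lf scalerDr !scalerA mulrC.
have /complex_realP[t ct] : `|c| \is Num.real by exact: normr_real.
exists (t * M%:R) => x; rewrite normrZ rmorphM /= rmorph_nat -ct -mulrA.
by rewrite ler_wpM2l.
Qed.

Lemma bounded_add f g : bounded_operator f -> bounded_operator g ->
  bounded_operator (fun x => f x + g x).
Proof.
move=> /bounded_natP[lf [M fM]] /bounded_natP[lg [N gN]].
apply/bounded_natP; split=> [c x y|].
  by rewrite lf lg scalerDr addrACA.
exists (M + N)%N => x; rewrite natrD mulrDl (le_trans (ler_normD _ _)) //.
exact: lerD.
Qed.

Lemma normal_iter p f : normal_operator f -> normal_operator (iter p f).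
Proof.
move=> [bf [fs [bfs adj c]]]; split; first exact: bounded_iter.
exists (iter p fs); split; [exact: bounded_iter | exact: is_adjoint_iter |].
exact: iter_commute2.
Qed.

Lemma normal_id : normal_operator (@id H).
Proof. by split; [|exists id; split=> //]; exact: bounded_id. Qed.

Lemma normal_scale c f :
  normal_operator f -> normal_operator (fun x => c *: f x).
Proof.
move=> [bf [fs [bfs adj cf]]]; split; first exact: bounded_scale.
exists (fun x => c^* *: fs x); split; first exact: bounded_scale.
  by move=> x y; rewrite innerZl innerZr conjCK adj.
have [[lf _] [lfs _]] := (bf, bfs).
move: lf lfs cf => /linear_ex[f' ->] /linear_ex[g' ->] cf x /=.
rewrite [f' (_ *: _)]linearZ_LR [g' (_ *: _)]linearZ_LR.
by rewrite !scalerA mulrC [f' _]cf.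
Qed.

Lemma normal_adjoint_commute f fs g :
  bounded_operator f -> bounded_operator fs -> is_adjoint f fs ->
  f \o fs =1 fs \o f -> bounded_operator g -> f \o g =1 g \o f ->
  fs \o g =1 g \o fs.
Proof.
move=> /bounded_natP[/linear_ex[f' ->] [M fM]] [/linear_ex[fs' ->] _] adj c.
move=> /bounded_natP[/linear_ex[g' ->] [b gb]] fg.
exact: (Fuglede adj c fg fM gb).
Qed.

(** The adjoint is [fs + gs]; its mixed products with [f + g] commute because Fuglede's theorem
    gives [fs g = g fs] and [gs f = f gs]. *)
Lemma normal_add f g : normal_operator f -> normal_operator g ->
  f \o g =1 g \o f -> normal_operator (fun x => f x + g x).
Proof.
move=> [bf [fs [bfs af cf]]] [bg [gs [bgs ag cg]]] fg.
have fsg := normal_adjoint_commute bf bfs af cf bg fg.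
have gsf := normal_adjoint_commute bg bgs ag cg bf (fsym fg).
split; first exact: bounded_add.
exists (fun x => fs x + gs x); split; first exact: bounded_add.
  by move=> x y; rewrite innerDl innerDr af ag.
move=> x /=; move: bf bfs bg bgs => [lf _] [lfs _] [lg _] [lgs _].
move: lf lfs lg lgs cf cg fsg gsf => /linear_ex[{af fg}f ->].
move=> /linear_ex[{}fs ->].
move=> /linear_ex[{ag}g ->] /linear_ex[{}gs ->] cf cg fsg gsf.
rewrite [f (_ + _)]linearD [g (_ + _)]linearD.
rewrite [fs (_ + _)]linearD [gs (_ + _)]linearD [f (fs x)]cf [g (gs x)]cg.
rewrite -[g (fs x)]fsg -[f (gs x)]gsf /=.
exact: addrACA.
Qed.

Lemma commute_iter p f h : h \o f =1 f \o h -> h \o iter p f =1 iter p f \o h.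
Proof. by move=> hf x; rewrite /= iter_commute // => y; exact/esym/hf. Qed.

End NormalOperators.

(** * Commutation, normality and intertwining for the extended tuple *)

Section ExtendTuple.
Variables (R : realType) (H : hilbertType R) (n m p : nat) (a : R[i]).
Implicit Types (V : 'I_n -> H -> H) (h : H -> H).

Lemma commute_shift_tuple V h i :
  (forall j, h \o V j =1 V j \o h) ->
  h \o shift_tuple V i =1 shift_tuple V i \o h.
Proof.
by move=> hV x; rewrite /shift_tuple; case: unlift => //= j; exact: hV.
Qed.

(** Each entry is a polynomial in the [V j]. Applied first to [h = V k] and then to [h] an entry,
    this yields commutation of the whole extended tuple. *)
Lemma commute_extend_tuple V h i : linear h ->
  (forall j, h \o V j =1 V j \o h) ->
  h \o extend_tuple m p a V i =1 extend_tuple m p a V i \o h.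
Proof.
move=> /linear_ex[{}h ->] hV x; have hS i' := commute_shift_tuple i' hV.
rewrite /extend_tuple /=; case: unlift => [j|].
  rewrite [h (_ + _)]linearD [h (_ *: _)]linearZ_LR [h _]hS /=; congr (_ + _).
  by case: ifP => _; [exact: commute_iter | exact: hV].
by rewrite [h (_ *: _)]linearZ_LR [h _]hS.
Qed.

Lemma commuting_shift_tuple V :
  commuting_operators V -> commuting_operators (shift_tuple V).
Proof.
move=> [bV cV]; split=> [i|i j].
  by rewrite /shift_tuple; case: unlift => // ; exact: bounded_id.
apply: commute_shift_tuple => k x; apply/esym; move: x.
by apply: commute_shift_tuple => l; exact: cV.
Qed.

Lemma commuting_extend_tuple V :
  commuting_operators V -> commuting_operators (extend_tuple m p a V).
Proof.
move=> cV; have [bS _] := commuting_shift_tuple cV; move: cV => [bV cV].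
have bE i : bounded_operator (extend_tuple m p a V i).
  rewrite /extend_tuple; case: unlift => [j|]; last exact: bounded_scale.
  apply: bounded_add; first exact: bounded_scale.
  by case: eqP => _ //; exact: bounded_iter.
split=> [//|i j]; apply: commute_extend_tuple; first by case: (bE i).
move=> k x; apply/esym; move: x.
by apply: commute_extend_tuple; [case: (bV k) | move=> l; exact: cV].
Qed.

Lemma normal_extend_tuple V i : commuting_operators V ->
  (forall j, normal_operator (V j)) -> normal_operator (extend_tuple m p a V i).
Proof.
move=> cV nV; have [bS cS] := commuting_shift_tuple cV; move: cV => [bV cV].
have nS k : normal_operator (shift_tuple V k).
  by rewrite /shift_tuple; case: unlift => //; exact: normal_id.
rewrite /extend_tuple; case: unlift => [j|]; last exact: normal_scale.
have SV : shift_tuple V i \o V j =1 V j \o shift_tuple V i.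
  by move=> x; apply/esym; move: x; apply: commute_shift_tuple => l; exact: cV.
pose W x := if j.+1 == n then iter p (V j) x else V j x.
have nW : normal_operator W.
  by rewrite /W; case: eqP => _ //; exact: normal_iter.
have SW : shift_tuple V i \o W =1 W \o shift_tuple V i.
  by rewrite /W; case: eqP => _ //; exact: commute_iter.
apply: (@normal_add _ _ _ W) => //; first exact: normal_scale.
have [[/linear_ex[W' WE] _] _] := nW; rewrite {}WE in SW *.
by move=> x /=; rewrite [W' (_ *: _)]linearZ_LR -[W' (shift_tuple _ _ _)]SW.
Qed.

Lemma extend_tuple_intertwine (K : hilbertType R) (J : {linear H -> K})
    V (N : 'I_n -> K -> K) i x :
  (forall i x, N i (J x) = J (V i x)) ->
  extend_tuple m p a N i (J x) = J (extend_tuple m p a V i x).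
Proof.
move=> NJ; have SJ k y : shift_tuple N k (J y) = J (shift_tuple V k y).
  by rewrite /shift_tuple; case: unlift => [j|].
rewrite /extend_tuple; case: unlift => [j|]; last first.
  by rewrite SJ [J (_ *: _)]linearZ_LR.
rewrite [J (_ + _)]linearD [J (_ *: _)]linearZ_LR SJ; congr (_ + _).
case: ifP => // _.
by elim: p => //= k ->; rewrite NJ.
Qed.

End ExtendTuple.

(** * The Koszul complex *)

Section Koszul.
Variables (R : realType) (H : hilbertType R) (d : nat).
Local Notation form := ({set 'I_d} -> H).
Implicit Types (f g : form) (B : {set 'I_d}) (i j k l : 'I_d).

(** The sign that moves [e_i] from the front to its place in the increasing wedge product. *)
Definition sgn i B : R[i] := (-1) ^+ #|[set j in B | (j < i)%N]|.

(* Exterior multiplication by [e_i] and its adjoint, the contraction by [e_i];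
   they satisfy the canonical anticommutation relations. *)
Definition create i f : form :=
  fun B => if i \in B then sgn i B *: f (B :\ i) else 0.

Definition annih i f : form :=
  fun B => if i \in B then 0 else sgn i B *: f (i |: B).

Lemma sgn_setU1 i j B :
  i \notin B -> sgn j (i |: B) = (-1) ^+ (i < j)%N * sgn j B.
Proof.
move=> iB; rewrite /sgn -exprD; congr (_ ^+ _).
have -> : [set k in i |: B | (k < j)%N] =
          if (i < j)%N then i |: [set k in B | (k < j)%N]
          else [set k in B | (k < j)%N].
  apply/setP => k; case: ifP => ij; rewrite !inE; case: eqP => [->|] //=.
  by rewrite ij (negbTE iB).
by case: ifP => //= ij; rewrite cardsU1 inE (negbTE iB).
Qed.

Lemma sgn_setD1 i j B :
  i \in B -> sgn j (B :\ i) = (-1) ^+ (i < j)%N * sgn j B.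
Proof.
move=> iB; rewrite -{2}(setD1K iB) sgn_setU1 ?setD11 //.
by rewrite mulrA -signr_addb addbb mul1r.
Qed.

Lemma mem_setD1_neq i j B : i != j -> (i \in B :\ j) = (i \in B).
Proof. by move=> ij; rewrite !inE; case: eqP ij => // ->; rewrite eqxx. Qed.

Lemma mem_setU1_neq i j B : i != j -> (i \in j |: B) = (i \in B).
Proof. by move=> ij; rewrite !inE; case: eqP ij => // ->; rewrite eqxx. Qed.

Lemma sgn_sqr i B : sgn i B * sgn i B = 1.
Proof. by rewrite /sgn -expr2 sqrr_sign. Qed.

Lemma sign_lt_ord i j : i != j ->
  (-1) ^+ (i < j)%N = - (-1) ^+ (j < i)%N :> R[i].
Proof. by rewrite -val_eqE; case: ltngtP => //= _ _; rewrite ?opprK. Qed.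

Lemma createC i j f : create i (create j f) = - create j (create i f).
Proof.
apply/funext => B; rewrite [RHS]/= /create opprfctE.
have [<-|ij] := eqVneq i j; first by rewrite setD11 scaler0 if_same oppr0.
rewrite mem_setD1_neq 1?eq_sym // mem_setD1_neq //.
case: ifP => iB; case: ifP => jB; rewrite ?scaler0 ?oppr0 //.
rewrite !scalerA -scaleNr !sgn_setD1 // (sign_lt_ord ij).
rewrite setDDl setUC -setDDl; congr (_ *: _); ring.
Qed.

Lemma create_annih i j f :
  annih i (create j f) + create j (annih i f) = if i == j then f else 0.
Proof.
apply/funext => B; rewrite /create /annih addrfctE.
have [<-|ij] := eqVneq i j.
  rewrite setD11 setU11; case: ifP => iB.
    by rewrite add0r sgn_setD1 // ltnn mul1r scalerA sgn_sqr scale1r setD1K.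
  rewrite addr0 sgn_setU1 ?iB // ltnn mul1r scalerA sgn_sqr scale1r.
  by rewrite setU1K ?iB.
have ji : j != i by rewrite eq_sym.
rewrite mem_setU1_neq // mem_setD1_neq //.
case: ifP => iB; case: ifP => jB; rewrite ?scaler0 ?addr0 //.
rewrite !scalerA sgn_setU1 ?iB // sgn_setD1 // (sign_lt_ord ij).
have -> : (i |: B) :\ j = i |: (B :\ j).
  apply/setP => t; rewrite !inE; case: (t =P j) => [->|] //=.
  by case: eqP ji => // ->; rewrite eqxx.
rewrite -scalerDl; set x := (X in X *: _); have -> : x = 0 by rewrite /x; ring.
by rewrite scale0r.
Qed.

Fact create_linear i : linear (create i).
Proof.
move=> c f g; apply/funext => B.
rewrite -[RHS]/(c *: create i f B + create i g B) /create.
rewrite -[(_ + _) (B :\ i)]/(c *: f (B :\ i) + g (B :\ i)).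
by case: ifP => _; rewrite ?scaler0 ?addr0 // scalerDr !scalerA mulrC.
Qed.

HB.instance Definition _ i :=
  GRing.isLinear.Build R[i] form form _ (create i) (create_linear i).

Fact annih_linear i : linear (annih i).
Proof.
move=> c f g; apply/funext => B.
rewrite -[RHS]/(c *: annih i f B + annih i g B) /annih.
rewrite -[(_ + _) (i |: B)]/(c *: f (i |: B) + g (i |: B)).
by case: ifP => _; rewrite ?scaler0 ?addr0 // scalerDr !scalerA mulrC.
Qed.

HB.instance Definition _ i :=
  GRing.isLinear.Build R[i] form form _ (annih i) (annih_linear i).

Lemma create_comp i (Q : {linear H -> H}) f :
  create i (Q \o f) = Q \o create i f.
Proof.
apply/funext => B; rewrite /create /=.
by case: ifP => _; rewrite ?linear0 // [Q (_ *: _)]linearZ_LR.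
Qed.

Lemma annih_comp i (Q : {linear H -> H}) f :
  annih i (Q \o f) = Q \o annih i f.
Proof.
apply/funext => B; rewrite /annih /=.
by case: ifP => _; rewrite ?linear0 // [Q (_ *: _)]linearZ_LR.
Qed.

(** With the differential written as the sum of the [e_i T_i], later computations reduce to the
    anticommutation relations. *)
Lemma koszulE (T : 'I_d -> H -> H) f :
  koszul T f = \sum_i create i (T i \o f).
Proof.
apply/funext => B; rewrite fct_sumE /koszul big_mkcond /=.
by apply: eq_bigr => i _; rewrite /create.
Qed.

Lemma koszul_comp (T : 'I_d -> {linear H -> H}) (Q : {linear H -> H}) f :
  (forall i, Q \o T i =1 T i \o Q) ->
  koszul T (Q \o f) = Q \o koszul T f.
Proof.
move=> QT; apply/funext => B; rewrite /koszul /= linear_sum.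
by apply: eq_bigr => i _; rewrite [Q (_ *: _)]linearZ_LR [Q (T _ _)]QT.
Qed.

Fact koszul_linear (T : 'I_d -> {linear H -> H}) : linear (koszul T).
Proof.
move=> c f g; rewrite !koszulE scaler_sumr -big_split /=.
apply: eq_bigr => i _; rewrite -linearP; congr (create i _).
by apply/funext => B; rewrite /= linearP.
Qed.

HB.instance Definition _ (T : 'I_d -> {linear H -> H}) :=
  GRing.isLinear.Build R[i] form form _ (koszul T) (koszul_linear T).

Lemma create_koszul (T : 'I_d -> {linear H -> H}) l f :
  create l (koszul T f) = - koszul T (create l f).
Proof.
rewrite !koszulE [create l _]linear_sum -sumrN; apply: eq_bigr => i _.
by rewrite -create_comp; exact: createC.
Qed.

(** Cartan's homotopy formula: contraction by [e_k] is a homotopy between [T k] and 0. *)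
Lemma annih_koszul (T : 'I_d -> {linear H -> H}) k f :
  annih k (koszul T f) = T k \o f - koszul T (annih k f).
Proof.
apply/eqP; rewrite eq_sym subr_eq; apply/eqP.
rewrite !koszulE [annih k _]linear_sum -big_split /=.
under eq_bigr do rewrite -annih_comp /= create_annih.
by rewrite -big_mkcond (big_pred1 k).
Qed.

Lemma create_sqr i f : create i (create i f) = 0.
Proof.
apply/funext => B; rewrite /create setD11 scaler0.
by case: ifP.
Qed.

End Koszul.

(** * Operations preserving exactness of the Koszul complex *)

Section KoszulExact.
Variables (R : realType) (H : hilbertType R).

Section FixedSize.
Variable d : nat.
Implicit Types (T : 'I_d -> {linear H -> H}) (Q : {linear H -> H}).

Lemma koszul_exactP (T : 'I_d -> H -> H) : koszul_exact T <->
  forall f, koszul T f = 0 -> exists g, f = koszul T g.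
Proof.
split=> ex f f0.
  have [|g fg] := ex f; first by move=> B; rewrite f0.
  by exists g; apply/funext.
have [|g ->] := ex f; first exact/funext.
by exists g.
Qed.

Lemma koszul_exact_ext (T T' : 'I_d -> H -> H) :
  (forall i, T i =1 T' i) -> koszul_exact T -> koszul_exact T'.
Proof. by move=> TT'; have -> : T = T' by apply/funext => i; apply/funext. Qed.

Definition shear Q k l (f : {set 'I_d} -> H) := f + (Q \o create l (annih k f)).

Lemma koszul_shear T T' Q k l f :
  k != l -> (forall i, Q \o T i =1 T i \o Q) ->
  (forall i x, T' i x = T i x + (if i == l then Q (T k x) else 0)) ->
  koszul T' (shear Q k l f) = shear Q k l (koszul T f).
Proof.
move=> kl QT T'E.
have QT' i : Q \o T' i =1 T' i \o Q.
  move=> x; rewrite /= !T'E linearD [Q (T i x)]QT; congr (_ + _).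
  by case: ifP; rewrite ?linear0 // [Q (T k x)]QT.
have kT' g : koszul T' g = koszul T g + create l (Q \o T k \o g).
  rewrite !koszulE [X in _ + X](_ : _ =
    \sum_i if i == l then create l (Q \o T k \o g) else 0); last first.
    by rewrite -big_mkcond big_pred1_eq.
  rewrite -big_split /=; apply: eq_bigr => i _.
  have -> : T' i \o g = T i \o g + (if i == l then Q \o T k \o g else 0).
    apply/funext => B; rewrite /= T'E; congr (_ + _).
    by case: ifP.
  rewrite [create i _]linearD; congr (_ + _).
  by case: eqP => [->|_] //; exact: linear0.
rewrite /shear [koszul T' _]linearD /= koszul_comp // kT'.
have -> : koszul T' (create l (annih k f)) = koszul T (create l (annih k f)).
  rewrite kT'; set g := annih k f.
  by rewrite (create_comp l (Q \o T k)) create_sqr; apply/funext => B;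
    rewrite fctE /= !linear0 addr0.
rewrite annih_koszul [create l (_ - _)]linearB [X in _ - X]create_koszul opprK.
rewrite -addrA; congr (_ + _); apply/funext => B; rewrite /= linearD.
by congr (_ + _); rewrite (create_comp l (Q \o T k)) (create_comp l (T k)).
Qed.

(** For [k != l] the operator [e_l iota_k] has square 0, so changing the sign of [Q] inverts the
    shear. *)
Lemma shearK Q k l f : k != l ->
  shear Q k l (shear (-%R \o Q : {linear H -> H}) k l f) = f.
Proof.
move=> kl; rewrite /shear; set h := create l (annih k f).
have h0 : create l (annih k h) = 0.
  have := create_annih k l (annih k f); rewrite (negbTE kl) => /eqP.
  rewrite addr_eq0 => /eqP; rewrite -/h => ->.
  by rewrite [LHS]linearN; apply/eqP; rewrite oppr_eq0; apply/eqP/create_sqr.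
rewrite [annih k _]linearD /= annih_comp [create l (_ + _)]linearD /= -/h.
rewrite create_comp h0; apply/funext => B.
by rewrite /= !addrfctE /= !linear0 addr0 addrNK.
Qed.

(* The shear [1 + Q e_l iota_k] is an automorphism of the exterior algebra
   sending [e_k] to [e_k + Q e_l], hence an isomorphism of Koszul complexes. *)
Lemma koszul_exact_shear T T' Q k l :
  k != l -> (forall i, Q \o T i =1 T i \o Q) ->
  (forall i x, T' i x = T i x + (if i == l then Q (T k x) else 0)) ->
  koszul_exact T -> koszul_exact T'.
Proof.
move=> kl QT T'E /koszul_exactP exT; apply/koszul_exactP => f f0.
pose Q' : {linear H -> H} := -%R \o Q.
have QT' i : Q \o T' i =1 T' i \o Q.
  move=> x; rewrite /= !T'E linearD [Q (T i x)]QT; congr (_ + _).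
  by case: ifP; rewrite ?linear0 // [Q (T k x)]QT.
(* Since [k != l], [T'] and [T] agree at [k], so the shear by [- Q] carries cycles of [T'] back to
   cycles of [T]. *)
have [|g fg] := exT (shear Q' k l f).
  rewrite (@koszul_shear T' T Q') //.
  - rewrite f0 /shear !linear0 add0r; apply/funext => B; exact: (linear0 Q').
  - by move=> i x; rewrite /= [T' i (- _)]linearN [Q (T' i x)]QT'.
  move=> i x; rewrite !T'E (negbTE kl) addr0; case: ifP => _ /=.
    by rewrite addrK.
  by rewrite !addr0.
exists (shear Q k l g).
by rewrite (koszul_shear _ kl QT T'E) -fg shearK.
Qed.

(** Rescaling each [e_B] by the product of the [u i] over [B] conjugates one differential into the
    other. *)
Lemma koszul_exact_scale T (u : 'I_d -> R[i]) : (forall i, u i != 0) ->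
  koszul_exact T -> koszul_exact (fun i x => u i *: T i x).
Proof.
move=> u0 exT f f0; pose v (B : {set 'I_d}) := \prod_(i in B) u i.
have v0 B : v B != 0 by apply/prodf_neq0 => i _; exact: u0.
have kv g B : koszul (fun i x => u i *: T i x) (fun B => v B *: g B) B =
              v B *: koszul T g B.
  rewrite /koszul scaler_sumr; apply: eq_bigr => i iB.
  rewrite [T i _]linearZ_LR !scalerA; congr (_ *: _).
  by rewrite [v B](big_setD1 i) //= -/(v _); ring.
have [|g fg] := exT (fun B => (v B)^-1 *: f B).
  move=> B; apply: (scalerI (v0 B)); rewrite -kv scaler0 -[RHS](f0 B).
  congr (koszul _ _ B); apply/funext => C.
  by rewrite scalerA mulfV ?scale1r.
exists (fun B => v B *: g B) => B; rewrite kv -fg.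
by rewrite scalerA mulfV ?scale1r.
Qed.

(** By Cartan's formula, [c^-1 iota_s] is a contracting homotopy. *)
Lemma koszul_exact_unit T s (c : R[i]) :
  c != 0 -> (forall x, T s x = c *: x) -> koszul_exact T.
Proof.
move=> c0 Ts; apply/koszul_exactP => f f0; exists (c^-1 *: annih s f).
have := annih_koszul T s f; rewrite f0 linear0 => /esym/eqP.
rewrite subr_eq0 [koszul T (_ *: _)]linearZ_LR /= => /eqP <-.
by apply/funext => B; rewrite scalrfctE /= Ts scalerA mulVf ?scale1r.
Qed.

End FixedSize.
Section Zero.
Variables (n : nat) (s : 'I_n.+1).
Implicit Types (T : 'I_n.+1 -> {linear H -> H}) (U : 'I_n -> {linear H -> H}).

(** A form splits as [f0 + e_s /\ f1] with [f0], [f1] free of [e_s]; [restr] reads off [f0] over the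
    remaining indices, and [extend] embeds such forms back. *)
Definition restr (f : {set 'I_n.+1} -> H) : {set 'I_n} -> H :=
  fun C => f [set lift s j | j in C].

Definition extend (g : {set 'I_n} -> H) : {set 'I_n.+1} -> H :=
  fun B => if s \in B then 0 else g [set j | lift s j \in B].

Lemma mem_lift_imset j (C : {set 'I_n}) :
  (lift s j \in [set lift s j | j in C]) = (j \in C).
Proof. by rewrite mem_imset //; exact: lift_inj. Qed.

Lemma notin_lift_imset (C : {set 'I_n}) : s \notin [set lift s j | j in C].
Proof. by apply/imsetP => -[j _] /eqP; rewrite (negbTE (neq_lift s j)). Qed.

Lemma lift_imsetK (C : {set 'I_n}) :
  [set j | lift s j \in [set lift s j | j in C]] = C.
Proof. by apply/setP => j; rewrite inE mem_lift_imset. Qed.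

Lemma lift_preimsetK (B : {set 'I_n.+1}) : s \notin B ->
  [set lift s j | j in [set j | lift s j \in B]] = B.
Proof.
move=> sB; apply/setP => i; case: (unliftP s i) => [j ->|->].
  by rewrite mem_lift_imset inE.
by rewrite (negbTE sB) (negbTE (notin_lift_imset _)).
Qed.

Lemma lift_imsetD1 j (C : {set 'I_n}) :
  [set lift s j | j in C] :\ lift s j = [set lift s j | j in C :\ j].
Proof.
apply/setP => i; case: (unliftP s i) => [k ->|->].
  by rewrite in_setD1 !mem_lift_imset in_setD1 (inj_eq lift_inj).
by rewrite in_setD1 !(negbTE (notin_lift_imset _)) andbF.
Qed.

Lemma sgn_lift j (C : {set 'I_n}) :
  sgn R (lift s j) [set lift s j | j in C] = sgn R j C.
Proof.
rewrite /sgn; congr (_ ^+ _).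
rewrite -(card_imset (mem [set k in C | (k < j)%N]) (@lift_inj _ s)).
apply: eq_card => i; case: (unliftP s i) => [k ->|->].
  rewrite inE !mem_lift_imset inE; congr (_ && _).
  by rewrite /= /bump; do 2 case: leqP; lia.
by rewrite inE !(negbTE (notin_lift_imset _)).
Qed.

Lemma restrK g : restr (extend g) = g.
Proof.
apply/funext => C; rewrite /restr /extend (negbTE (notin_lift_imset C)).
by rewrite lift_imsetK.
Qed.

Lemma koszul_restr T U f : (forall j, T (lift s j) =1 U j) ->
  koszul U (restr f) = restr (koszul T f).
Proof.
move=> TU; apply/funext => C; rewrite /restr /koszul.
rewrite big_imset /=; last by move=> i j _ _; exact: lift_inj.
apply: eq_bigr => j jC; rewrite TU -/(sgn R j C) -sgn_lift.
congr (_ *: U j (f _)).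
by rewrite lift_imsetD1.
Qed.

Lemma koszul_extend T U g : (forall j, T (lift s j) =1 U j) ->
  (forall x, T s x = 0) -> koszul T (extend g) = extend (koszul U g).
Proof.
move=> TU Ts; apply/funext => B; rewrite [RHS]/extend; case: ifP => sB.
  rewrite /koszul big1 // => i iB; have [->|si] := eqVneq i s.
    by rewrite Ts scaler0.
  by rewrite /extend mem_setD1_neq 1?eq_sym // sB linear0 scaler0.
rewrite -[in LHS](lift_preimsetK (negbT sB)) -/(restr (koszul T (extend g)) _).
by rewrite -(koszul_restr _ TU) restrK.
Qed.

Lemma extend_restr f :
  f = extend (restr f) + create s (extend (restr (annih s f))).
Proof.
apply/funext => B; rewrite addrfctE /create /extend /restr /annih.
case: ifP => sB; last by rewrite addr0 lift_preimsetK ?sB.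
rewrite setD11 lift_preimsetK ?setD11 // add0r scalerA.
by rewrite sgn_setD1 // ltnn mul1r sgn_sqr scale1r setD1K.
Qed.

(** When [T s = 0] the differential respects the splitting, and both components of a cycle are
    cycles for [U]; for [f1] this is Cartan's formula. *)
Lemma koszul_exact_zero T U : (forall j, T (lift s j) =1 U j) ->
  (forall x, T s x = 0) -> koszul_exact U -> koszul_exact T.
Proof.
move=> TU Ts /koszul_exactP exU; apply/koszul_exactP => f f0.
have [|g0 fg0] := exU (restr f); first by rewrite (koszul_restr _ TU) f0.
have [|g1 fg1] := exU (restr (annih s f)).
  rewrite (koszul_restr _ TU); have := annih_koszul T s f.
  rewrite f0 linear0 => /esym/eqP; rewrite subr_eq0 => /eqP <-.
  by apply/funext => C; rewrite /restr /= Ts.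
(* The minus sign compensates the anticommutation of [e_s] with the differential. *)
exists (extend g0 - create s (extend g1)).
rewrite [koszul T (_ - _)]linearB [X in _ - X]/= -create_koszul.
by rewrite /= !(koszul_extend _ TU Ts) -fg0 -fg1 -extend_restr.
Qed.

End Zero.
End KoszulExact.

Lemma linear_tuple_ex (R : realType) (H : hilbertType R) d
    (T : 'I_d -> H -> H) :
  (forall i, linear (T i)) -> exists T' : 'I_d -> {linear H -> H}, T = T'.
Proof.
move=> lT.
by exists (fun i => HB.pack_for {linear H -> H} (T i)
  (GRing.isLinear.Build R[i] H H _ (T i) (lT i))).
Qed.

(** * The joint spectrum of the extended tuple *)

Section SpectralMapping.
Variables (R : realType) (H : hilbertType R).

(** One shear per row, from the largest index downwards: in [E k] the rows from [k] on are modified,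
    so row [pr k], being smaller, is still the original one when it is added. *)
Lemma koszul_exact_bidiagonal d (T : 'I_d -> {linear H -> H}) (b : 'I_d -> R[i])
    (pr : 'I_d -> 'I_d) :
  (forall i, b i != 0 -> (pr i < i)%N) -> koszul_exact T ->
  koszul_exact (fun i x => T i x + b i *: T (pr i) x).
Proof.
move=> prb exT.
pose E k i : {linear H -> H} :=
  T i \+ (if (k <= i)%N then b i else 0) \*: T (pr i).
suff: forall t, (t <= d)%N -> koszul_exact (E (d - t)%N).
  by move=> /(_ d (leqnn d)); rewrite subnn; apply: koszul_exact_ext.
elim=> [_|t IH td].
  rewrite subn0; apply: koszul_exact_ext exT => i x.
  by rewrite /= leqNgt ltn_ord /= scale0r addr0.
have := IH (ltnW td); rewrite -(subnSK td); set k := (d - t.+1)%N => exk.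
have kd : (k < d)%N by rewrite /k ltn_subrL; lia.
pose l := Ordinal kd.
have [b0|b0] := eqVneq (b l) 0.
  apply: koszul_exact_ext exk => i x /=; rewrite [(k <= i)%N]leq_eqVlt.
  case: eqP => //= ki; rewrite -ki ltnn; have <- : l = i by exact: val_inj.
  by rewrite b0.
pose Q : {linear H -> H} := b l \*: idfun.
apply: (@koszul_exact_shear _ _ _ (E k.+1) (E k) Q (pr l) l _ _ _ exk).
- by rewrite -val_eqE neq_ltn prb.
- by move=> i x; symmetry; exact: (linearZ_LR (E k.+1 i)).
move=> i x /=; have := prb l b0 => /= plk.
have -> : (k < pr l)%N = false by lia.
rewrite scale0r addr0; case: (i =P l) => [->|il].
  by rewrite leqnn ltnn scale0r addr0.
rewrite addr0 [(k <= i)%N]leq_eqVlt; case: eqP => // ki.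
case: il; exact/val_inj.
Qed.

(** [Q] is the usual cofactor of [N - z] in [N^p - z^p], built by [Q_(p+1) = N^p + z Q_p]; as a
    polynomial in [N] it commutes with whatever commutes with [N]. *)
Lemma iter_sub_factor (N : {linear H -> H}) (z : R[i]) p :
  exists Q : {linear H -> H},
    (forall x, iter p N x - z ^+ p *: x = Q (N x - z *: x)) /\
    forall T : {linear H -> H}, T \o N =1 N \o T -> Q \o T =1 T \o Q.
Proof.
elim: p => [|p [Q [QE QT]]].
  exists (0 \*: idfun); split=> [x|T _ x]; rewrite /= !scale0r ?linear0 //.
  by rewrite expr0 scale1r subrr.
have lN k : linear (iter k N).
  by elim: k => [|k IH] c u v /=; rewrite ?IH ?linearP.
have [Np NpE] := linear_ex (lN p).
exists (Np \+ z \*: Q); split=> [x|T TN x].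
  rewrite /= -QE [Np (_ - _)]linearB [Np (_ *: _)]linearZ_LR -NpE -iterSr /=.
  by rewrite scalerBr scalerA -exprS addrA addrNK.
rewrite /= [T (_ + _)]linearD [T (_ *: _)]linearZ_LR [Q (T x)]QT //.
by congr (_ + _); rewrite -NpE; exact/esym/commute_iter.
Qed.

Section ExtendSpectrum.
Variables (n m p : nat) (a : R[i]).

(** [extend_tuple] on scalars; [sz] encodes the convention that the coordinate before the first is
    1. *)
Definition extend_point (z : 'I_n -> R[i]) (i : 'I_n.+1) : R[i] :=
  let sz i := if unlift ord0 i is Some j then z j else 1 in
  if unlift ord_max i is Some j then
    a ^+ m * sz i + (if j.+1 == n then z j ^+ p else z j)
  else a ^+ (m %/ p) * sz i.

(** Solves [b z_(k-1) + z_k = w_k] recursively, starting from [z_(-1) = 1]. *)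
Fixpoint back_solve (b : R[i]) (w : nat -> R[i]) k : R[i] :=
  if k is k'.+1 then w k - b * back_solve b w k' else w 0%N - b.

(** The first [n - 1] equations are triangular and the last one, [a^(m/p) z_(n-1) = w_n], is linear;
    the omitted equation is the one containing the [p]-th power. *)
Lemma extend_point_solve (w : 'I_n.+1 -> R[i]) : (0 < n)%N -> a != 0 ->
  exists z, forall i : 'I_n.+1, i.+1 != n -> extend_point z i = w i.
Proof.
move=> n0 a0; pose w' k := w (inord k).
exists (fun j => if j.+1 == n then (a ^+ (m %/ p))^-1 * w ord_max
                 else back_solve (a ^+ m) w' j) => i iN.
rewrite /extend_point; case: (unliftP ord_max i) iN => [j ->|->] iN.
  have bj : bump n j = j by rewrite /bump leqNgt ltn_ord.
  have jE : lift ord_max j = j :> nat by rewrite lift_max.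
  rewrite jE in iN; rewrite (negbTE iN).
  have wj : w (lift ord_max j) = w' j.
    by rewrite /w'; congr w; apply: val_inj; rewrite /= bj inordK // ltnW ?ltnS.
  case: (unliftP ord0 (lift ord_max j)) => [k|] /(congr1 val) /=.
    rewrite bj /bump /= add1n => jk.
    have -> : (k.+1 == n) = false by rewrite -jk ltn_eqF.
    by rewrite wj jk /= addrCA subrr addr0.
  rewrite bj => j0.
  by rewrite wj j0 /= mulr1 addrCA subrr addr0.
case: (unliftP ord0 ord_max) => [k|] /(congr1 val) /= nk; last first.
  by rewrite nk in n0.
move: nk; rewrite /bump /= add1n => <-; rewrite eqxx mulrA mulfV ?mul1r //.
by rewrite expf_neq0.
Qed.

(** [D] lists the [N j - z j] with the scalar defect inserted at [s]. Three moves lead to the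
    target: a shear creating the [p]-th power at [s], the addition of [a^m] times the preceding
    entry, and a rescaling of the last entry. *)
Lemma koszul_exact_extend (N : 'I_n -> {linear H -> H}) (z : 'I_n -> R[i])
    (w : 'I_n.+1 -> R[i]) (l : 'I_n) (s := lift ord_max l)
    (D : 'I_n.+1 -> {linear H -> H}) :
  a != 0 -> l.+1 = n -> (forall i j, N i \o N j =1 N j \o N i) ->
  (forall i : 'I_n.+1, i.+1 != n -> extend_point z i = w i) ->
  (forall j x, D (lift s j) x = N j x - z j *: x) ->
  (forall x, D s x = (extend_point z s - w s) *: x) ->
  koszul_exact D ->
  koszul_exact (fun i x => extend_tuple m p a N i x - w i *: x).
Proof.
move=> a0 ln cN zw DN Ds exD; set c := extend_point z s - w s in Ds.
have [Q [QE QN]] := iter_sub_factor (N l) (z l) p.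
have bl (j : 'I_n) : bump n j = j by rewrite /bump leqNgt ltn_ord.
have slift : lift s l = ord_max.
  by apply: val_inj; rewrite /= bl /bump leqnn add1n ln.
have ms : ord_max != s by rewrite -slift eq_sym neq_lift.
have lift_ne (j : 'I_n) : (j.+1 == n) = false -> lift ord_max j = lift s j.
  move=> jn; apply: val_inj; rewrite /= !bl /bump leqNgt.
  by have -> : (j < l)%N by have := ltn_ord j; lia.
have sl (j : 'I_n) : (lift ord_max j == s) = (j.+1 == n).
  by rewrite (inj_eq lift_inj) -val_eqE /= -eqSS ln.
(* [D ord_max] is [N l - z l], so [Q] turns it into [N l ^ p - z l ^ p]. *)
pose Ts : {linear H -> H} := D s \+ (Q \o D ord_max).
pose T1 i : {linear H -> H} := if i == s then Ts else D i.
have ex1 : koszul_exact T1.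
  apply: (@koszul_exact_shear _ _ _ D T1 Q ord_max s ms _ _ exD).
    move=> i x; case: (unliftP s i) => [j ->|->] /=; last first.
      by rewrite !Ds [Q (_ *: _)]linearZ_LR.
    by rewrite !DN [Q (_ - _)]linearB [Q (_ *: _)]linearZ_LR [Q (N j x)]QN.
  move=> i x; rewrite /T1; case: eqP => [->|] //=; by rewrite addr0.
(* Entry 0 has no predecessor, its [a^m I] being a scalar absorbed with [w]; entry [n] is only
   rescaled. *)
pose b (i : 'I_n.+1) := if (0 < i < n)%N then a ^+ m else 0.
pose pr (i : 'I_n.+1) : 'I_n.+1 := inord i.-1.
pose T2 i : {linear H -> H} := T1 i \+ b i \*: T1 (pr i).
have ex2 : koszul_exact T2.
  apply: koszul_exact_ext (koszul_exact_bidiagonal _ ex1) => [i x //|i].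
  rewrite /b; case: ifP => [/andP[i0 _] _|]; last by rewrite eqxx.
  by rewrite /pr inordK ?prednK // ltnW // ltnS.
pose u (i : 'I_n.+1) := if i == ord_max then a ^+ (m %/ p) else 1.
have u0 i : u i != 0.
  by rewrite /u; case: ifP => _; rewrite ?expf_neq0 ?oner_neq0.
apply: koszul_exact_ext (koszul_exact_scale u0 ex2) => i x /=.
rewrite /u; case: (unliftP ord_max i) => [j ->|->]; last first.
  have ul : unlift ord0 (ord_max : 'I_n.+1) = Some l.
    rewrite -(liftK ord0 l); congr unlift; apply: val_inj.
    by rewrite /= /bump /= add1n ln.
  rewrite eqxx /b /= ltnn andbF scale0r addr0 /T1 (negbTE ms) -slift DN slift.
  have <- : extend_point z ord_max = w ord_max by apply: zw; rewrite /= gtn_eqF.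
  rewrite /extend_tuple /extend_point /shift_tuple unlift_none ul.
  by rewrite scalerBr scalerA.
rewrite eq_sym (negbTE (neq_lift _ _)) scale1r.
rewrite /extend_tuple liftK; set i' := lift ord_max j.
set S := shift_tuple N i' x; set W := (if j.+1 == n then _ else _).
pose sz := if unlift ord0 i' is Some k then z k else 1.
(* At [s] the defect supplies exactly the scalar missing from [N^p - z^p]; elsewhere this is the
   equation for [z]. *)
have -> : T1 i' x = W - (w i' - a ^+ m * sz) *: x.
  rewrite /T1 sl /W; case: eqP => jn.
    have jl : j = l by apply: val_inj; apply: succn_inj; rewrite ln.
    rewrite /= Ds -slift DN -QE /c -jl addrC -addrA; congr (_ + _).
    rewrite -/i' in sz *; have -> : s = i' by rewrite /i' jl.
    rewrite /extend_point {1}/i' liftK -/i' -/sz jn eqxx.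
    by rewrite -[RHS]scaleNr -scaleNr -scalerDl; congr (_ *: _); ring.
  have -> : D i' x = N j x - z j *: x by rewrite /i' lift_ne ?DN //; apply/eqP.
  have <- : extend_point z i' = w i'.
    by apply: zw; rewrite /i' lift_max; apply/eqP.
  rewrite /extend_point {1}/i' liftK -/i' -/sz; case: eqP => // _.
  by congr (_ - _ *: _); ring.
have -> : b i' *: T1 (pr i') x = a ^+ m *: S - (a ^+ m * sz) *: x.
  rewrite /S /sz /shift_tuple; case: (unliftP ord0 i') => [k|] ik; last first.
    by rewrite /b ik /= scale0r mulr1 subrr.
  have jk : j = k.+1 :> nat.
    by move/(congr1 val): ik; rewrite /i' /= bl /bump /= add1n.
  rewrite /b /pr /i' lift_max jk /=; have kn : (k.+1 < n)%N by rewrite -jk.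
  have kn' : (k.+1 == n) = false by rewrite ltn_eqF.
  rewrite kn (_ : inord k = lift ord_max k); last first.
    by apply: val_inj; rewrite /= bl inordK // ltnW // ltnS ltnW.
  by rewrite /T1 sl kn' lift_ne // DN scalerBr scalerA.
by rewrite scalerBl opprB addrC !addrA [_ - _ + W]addrAC addrNK.
Qed.

Lemma joint_spectrum_extend (N : 'I_n -> H -> H) (w : 'I_n.+1 -> R[i]) :
  a != 0 -> (0 < n)%N -> commuting_operators N ->
  joint_spectrum (extend_tuple m p a N) w ->
  exists2 z, joint_spectrum N z & w = extend_point z.
Proof.
move=> a0 n0 [bN cN]; have [|N' NE] := @linear_tuple_ex R H n N.
  by move=> i; case: (bN i).
rewrite {}NE in cN * => wM.
have [z zw] := extend_point_solve w n0 a0.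
have ltn : (n.-1 < n)%N by rewrite ltn_predL.
pose l := Ordinal ltn.
have ln : l.+1 = n by rewrite /= prednK.
pose s := lift ord_max l; set c := extend_point z s - w s.
pose D (i : 'I_n.+1) : {linear H -> H} :=
  if unlift s i is Some j then N' j \- z j \*: idfun else c \*: idfun.
have DN j x : D (lift s j) x = N' j x - z j *: x by rewrite /D liftK.
have Ds x : D s x = c *: x by rewrite /D unlift_none.
have nexD : ~ koszul_exact D.
  by move=> /(koszul_exact_extend a0 ln cN zw DN Ds).
(* A nonzero defect would make the complex exact, contrary to [w] being in the spectrum; hence [w]
   is [extend_point z] in every coordinate. *)
have c0 : c = 0.
  by apply/eqP/negP => /negP c0; apply: nexD; exact: koszul_exact_unit c0 Ds.
exists z.
  pose U i : {linear H -> H} := N' i \- z i \*: idfun.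
  move=> exU; apply/nexD/(@koszul_exact_zero _ _ _ s D U) => //.
  by move=> x; rewrite Ds c0 scale0r.
apply/funext => i; case: (eqVneq i s) => [->|si]; apply/esym.
  by apply/eqP; rewrite -subr_eq0 -/c c0.
apply: zw; apply: contra si => /eqP iN.
by apply/eqP/val_inj; rewrite /s [RHS]lift_max; apply: succn_inj; rewrite ln.
Qed.

End ExtendSpectrum.
End SpectralMapping.

(** * Elementary symmetric polynomials and the map theta *)

(** Expanding the product over subsets, [B] contributes to degree [#|B|]. Adjoining a variable [a]
    then amounts to multiplication by [1 + a X]. *)
Lemma elem_sym_coef (R : realType) d k (z : 'I_d -> R[i]) :
  elem_sym k z = (\prod_i (1 + (z i)%:P * 'X))`_k.
Proof.
under eq_bigr do rewrite addrC; rewrite bigA_distr.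
rewrite coef_sum /elem_sym [LHS]big_mkcond /=; apply: eq_bigr => B _.
rewrite -big_mkcond /= big_split /= -rmorph_prod prodr_const coefCM coefXn.
by rewrite eq_sym; case: eqP; rewrite ?mulr1 ?mulr0.
Qed.

Section ElementarySymmetric.
Variables (R : realType) (d : nat).
Implicit Types z : 'I_d -> R[i].

Lemma elem_sym0 z : elem_sym 0 z = 1.
Proof.
rewrite /elem_sym (big_pred1 set0) ?big_set0 // => B.
by rewrite cards_eq0.
Qed.

Lemma elem_sym_max z : elem_sym d z = \prod_i z i.
Proof.
rewrite /elem_sym (big_pred1 [set: 'I_d]) => [|B].
  by apply: eq_bigl => i; rewrite inE.
have Bd : (#|B| <= d)%N by have := max_card (mem B); rewrite card_ord.
by rewrite /= eqEcard finset.subsetT cardsT card_ord eqn_leq Bd.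
Qed.

Definition snoc z (a : R[i]) (i : 'I_d.+1) : R[i] :=
  if unlift ord_max i is Some j then z j else a.

Lemma prod_snoc (T : comNzRingType) (F : R[i] -> T) z a :
  \prod_i F (snoc z a i) = (\prod_i F (z i)) * F a.
Proof.
rewrite big_ord_recr /= /snoc unlift_none; congr (_ * _).
apply: eq_bigr => i _.
have -> : widen_ord (leqnSn d) i = lift ord_max i.
  by apply: val_inj; rewrite /= /bump leqNgt ltn_ord.
by rewrite liftK.
Qed.

Lemma elem_sym_snoc k z a :
  elem_sym k.+1 (snoc z a) = elem_sym k.+1 z + a * elem_sym k z.
Proof.
have /= prodE := prod_snoc (fun x : R[i] => 1 + x%:P * 'X) z a.
rewrite !elem_sym_coef prodE mulrDr mulr1 coefD.
by rewrite mulrCA coefCM coefMX.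
Qed.

End ElementarySymmetric.

(** Below the last coordinate this is the recursion [s_i(t^m, a^m) = s_i(t^m) + a^m s_(i-1)(t^m)].
    For [i = n], [s_n(t^m)] is the [m]-th power of the product, which is the [p]-th power of the
    last coordinate of [theta] because [p] divides [m]. *)
Lemma theta_snoc (R : realType) (n m p : nat) (t : 'I_n -> R[i]) (a : R[i]) :
  (0 < n)%N -> (p %| m)%N ->
  theta m p (snoc t a) = extend_point m p a (theta m p t).
Proof.
move=> n0 pm; apply/funext => i; rewrite /extend_point.
have powE : (fun j => snoc t a j ^+ m) = snoc (fun j => t j ^+ m) (a ^+ m).
  by apply/funext => j; rewrite /snoc; case: unlift.
rewrite {1}/theta powE (prod_snoc id).
case: (unliftP ord_max i) => [j ->|->].
  have bj : bump n j = j by rewrite /bump leqNgt ltn_ord.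
  have -> : ((lift ord_max j).+1 == n.+1) = false.
    by rewrite lift_max eqSS ltn_eqF.
  rewrite lift_max elem_sym_snoc addrC; congr (_ * _ + _).
    case: (unliftP ord0 (lift ord_max j)) => [k|] /(congr1 val) /=.
      rewrite bj /bump /= add1n => jk.
      by rewrite jk /theta ltn_eqF // -jk.
    by rewrite bj => ->; rewrite elem_sym0.
  rewrite /theta; case: (j.+1 =P n) => [jn|//].
  by rewrite jn elem_sym_max -exprM divnK // prodrXl.
rewrite eqxx exprMn mulrC; congr (_ * _).
case: (unliftP ord0 ord_max) => [k|] /(congr1 val) /= nk.
  by move: nk; rewrite /bump /= add1n /theta => <-; rewrite eqxx.
by rewrite nk in n0.
Qed.

(** * Extension of the unitary dilation *)

Theorem theorem3p7 (R : realType) (m p n : nat)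
    (hm : (1 <= m)%N) (hp : (1 <= p)%N) (hpm : (p %| m)%N) (hn : (2 <= n)%N)
    (H : hilbertType R) (V : 'I_n -> H -> H)
    (hV : commuting_operators V)
    (hVi : Theta_isometry m p V) (a : R[i]) (ha : `|a| = 1) :
  Theta_isometry m p (extend_tuple m p a V).
Proof.
split; first exact: commuting_extend_tuple.
have [_ [K [J [N [isoJ [cN nN spN] NJ]]]]] := hVi.
have a0 : a != 0 by rewrite -normr_eq0 ha oner_neq0.
exists K, J, (extend_tuple m p a N); split=> //; last first.
  by move=> i x; exact: extend_tuple_intertwine.
split=> [|i|w wM].
- exact: commuting_extend_tuple.
- exact: normal_extend_tuple.
have [z /spN[t t1 <-] ->] := joint_spectrum_extend a0 (ltnW hn) cN wM.
(* Appending [a], which has modulus 1, to the torus point [t] gives a preimage of [w] under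
   [theta]. *)
exists (snoc t a); last by rewrite theta_snoc // ltnW.
by move=> j; rewrite /snoc; case: unlift => //=.
Qed.
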